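(* Let $\tau>0$ and consider the cubic polynomial $f_\tau(x)=(1+\tau)x-\tau x^3$ for $x\in\mathbb R$. The following hold. (i) If $0<\tau\le\frac12$, then $\max_{|x|\le1}|f_\tau(x)|=1$. Moreover, for any $1\le\alpha\le\sqrt{1+\frac2\tau}$ we have $\max_{|x|\le\alpha}|f_\tau(x)|\le\alpha$, and for any $1<\alpha<\sqrt{1+\frac2\tau}$ we have the strict inequality $\max_{|x|\le\alpha}|f_\tau(x)|<\alpha$. (ii) If $\frac12\le\tau\le2$, then for any $\frac{(1+\tau)^{3/2}}{\sqrt{3\tau}}\cdot\frac23\le\alpha\le\sqrt{\frac{2+\tau}{\tau}}$ we have $\max_{|x|\le\alpha}|f_\tau(x)|\le\alpha$. Furthermore, if $\frac{(1+\tau)^{3/2}}{\sqrt{3\tau}}\cdot\frac23<\alpha<\sqrt{\frac{2+\tau}{\tau}}$, then $\max_{|x|\le\alpha}|f_\tau(x)|<\alpha$. (iii) For $\tau>2$, define $x_0=\sqrt{\frac{1+\tau}{3\tau}}\in(0,1)$ and $x_{n+1}=f_\tau(x_n)$. Then $|x_n|\to\infty$ as $n\to\infty$. *)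

(* Defs.v *)
From HB Require Import structures.
From mathcomp Require Import all_boot all_order all_algebra.
From mathcomp Require Import all_classical all_reals all_analysis.

Set Implicit Arguments.
Unset Strict Implicit.
Unset Printing Implicit Defensive.

Import Order.TTheory GRing.Theory Num.Theory.
Import numFieldNormedType.Exports.

Local Open Scope classical_set_scope.
Local Open Scope ring_scope.

Definition cubic (R : realType) (tau x : R) : R := (1 + tau) * x - tau * x ^+ 3.

(* A relation rather than [sup A = m], so that the maximum has to be attained. *)
Definition is_max (R : realType) (A : set R) (m : R) : Prop :=
  A m /\ ubound A m.

Definition abs_values (R : realType) (f : R -> R) (alpha : R) : set R :=
  [set `|f x| | x in [set x | `|x| <= alpha]].

Definition crit_point (R : realType) (tau : R) : R :=
  Num.sqrt ((1 + tau) / (3 * tau)).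

Definition orbit_seq (R : realType) (tau : R) : R^nat :=
  fun n => iter n (cubic tau) (crit_point tau).

Definition crit_value (R : realType) (tau : R) : R :=
  (1 + tau) `^ (3 / 2) / Num.sqrt (3 * tau) * (2 / 3).

(* Main.v *)
(* With c the positive critical point, cubic c - cubic t = tau (t - c)^2 (t + 2c),
   so crit_value = cubic c bounds the cubic above on [0, +oo[; when tau <= 1/2 one
   has c >= 1, the values on [0, 1] stay in [0, 1], and cubic t <= t for t >= 1.
   Below, cubic t >= - t exactly as long as tau t^2 <= 2 + tau.  Oddness reduces
   absolute values to t >= 0.  When tau > 2 the first iterate crit_value already
   satisfies tau t^2 > 2 + tau, and from then on |x| grows at each step by at least
   the fixed amount by which it grows at crit_value. *)
Require Import Defs.
From HB Require Import structures.
From mathcomp Require Import all_boot all_order all_algebra.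
From mathcomp Require Import all_classical all_reals all_analysis.
From mathcomp Require Import ring lra.
Set Implicit Arguments.
Unset Strict Implicit.
Import Order.TTheory GRing.Theory Num.Theory.
Import numFieldNormedType.Exports.
Local Open Scope classical_set_scope.
Local Open Scope ring_scope.

Section Cubic.
Variables (R : realType) (tau : R).
Implicit Types t alpha : R.

(** * Oddness and attainment of the maximum *)

Lemma normr_cubic t : `|cubic tau `|t| | = `|cubic tau t|.
Proof.
have [t0|t0] := ger0P t; first by [].
by rewrite -normrN; congr `|_|; rewrite /cubic; ring.
Qed.

Lemma cubic_continuous : continuous (cubic tau).
Proof.
move=> x; rewrite /cubic; apply: cvgB; apply: cvgM; try exact: cvg_cst.
  exact: cvg_id.
exact: exprn_continuous.
Qed.

(** The extreme value theorem supplies a maximiser and oddness replaces it by its absolute value, so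
    later bounds are needed only for [0 <= t <= alpha]. *)
Lemma abs_values_cubic_max alpha : 0 <= alpha ->
  exists2 t, 0 <= t <= alpha &
    is_max (abs_values (cubic tau) alpha) `|cubic tau t|.
Proof.
move=> alpha0; have aNa : - alpha <= alpha by lra.
have cf : {within `[- alpha, alpha], continuous (fun x => `|cubic tau x|)}.
  apply: continuous_subspaceT => x.
  exact: (cvg_norm (@cubic_continuous x)).
have [c + cmax] := EVT_max aNa cf; rewrite in_itv /= -ler_norml => ca.
exists `|c|; first by rewrite normr_ge0.
split; first by exists `|c| => //=; rewrite normr_id.
move=> _ [x /= xa <-]; rewrite normr_cubic; apply: cmax.
by rewrite in_itv /= -ler_norml.
Qed.

(** * The critical point and its value *)

Lemma crit_point_gt0 (tau_gt0 : 0 < tau) : 0 < crit_point tau.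
Proof. by rewrite sqrtr_gt0 divr_gt0 //; lra. Qed.

Lemma sqr_crit_point (tau_gt0 : 0 < tau) :
  3 * tau * crit_point tau ^+ 2 = 1 + tau.
Proof.
rewrite sqr_sqrtr; last by rewrite divr_ge0 //; lra.
by field; lra.
Qed.

Lemma cubic_crit_point (tau_gt0 : 0 < tau) :
  cubic tau (crit_point tau) = crit_value tau.
Proof.
have u0 : 0 < 1 + tau by lra.
have -> : cubic tau (crit_point tau) = 2 / 3 * (1 + tau) * crit_point tau.
  by rewrite /cubic -(sqr_crit_point tau_gt0); field.
rewrite /crit_value /crit_point sqrtrM ?sqrtrV; [|lra..].
have -> : 3 / 2 = 1 + 2^-1 :> R by field.
rewrite powRD; last by rewrite (gt_eqF u0) implybT.
by rewrite powRr1 ?powR12_sqrt; [ring|lra..].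
Qed.

Lemma crit_value_gt0 (tau_gt0 : 0 < tau) : 0 < crit_value tau.
Proof.
by rewrite /crit_value !mulr_gt0 ?powR_gt0 ?invr_gt0 ?sqrtr_gt0 //; lra.
Qed.

Lemma cubic_le_crit_value t (tau_gt0 : 0 < tau) :
  0 <= t -> cubic tau t <= crit_value tau.
Proof.
move=> t0; rewrite -(cubic_crit_point tau_gt0) -subr_ge0.
have c0 := crit_point_gt0 tau_gt0.
have -> : cubic tau (crit_point tau) - cubic tau t =
    tau * ((t - crit_point tau) ^+ 2 * (t + 2 * crit_point tau)).
  by rewrite /cubic -(sqr_crit_point tau_gt0); ring.
by rewrite pmulr_rge0 // mulr_ge0 ?sqr_ge0 //; lra.
Qed.

(** * The escape radius and the lower bound *)

Lemma le_escape_radius t (tau_gt0 : 0 < tau) : 0 <= t ->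
  (t <= Num.sqrt ((2 + tau) / tau)) = (tau * t ^+ 2 <= 2 + tau).
Proof.
move=> t0; rewrite -[X in X <= _](ger0_norm t0) -sqrtr_sqr ler_sqrt.
  by rewrite ler_pdivlMr // mulrC.
by rewrite divr_ge0 //; lra.
Qed.

Lemma lt_escape_radius t (tau_gt0 : 0 < tau) : 0 <= t ->
  (t < Num.sqrt ((2 + tau) / tau)) = (tau * t ^+ 2 < 2 + tau).
Proof.
move=> t0; rewrite -[X in X < _](ger0_norm t0) -sqrtr_sqr ltr_sqrt.
  by rewrite ltr_pdivlMr // mulrC.
by rewrite divr_gt0 //; lra.
Qed.

(** The escape radius is thus the positive root of [cubic tau t = - t]: it and its opposite form a
    cycle of period two. *)
Lemma cubicDid t : cubic tau t + t = t * (2 + tau - tau * t ^+ 2).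
Proof. by rewrite /cubic; ring. Qed.

Lemma cubic_geN t alpha (tau_gt0 : 0 < tau) :
  alpha <= Num.sqrt ((2 + tau) / tau) ->
  0 <= t <= alpha -> - alpha <= cubic tau t.
Proof.
move=> asqrt /andP[t0 ta]; have := le_trans ta asqrt.
rewrite (le_escape_radius tau_gt0) // => ht.
have : 0 <= cubic tau t + t by rewrite cubicDid mulr_ge0 // subr_ge0.
lra.
Qed.

Lemma cubic_gtN t alpha (tau_gt0 : 0 < tau) :
  0 < alpha -> alpha < Num.sqrt ((2 + tau) / tau) ->
  0 <= t <= alpha -> - alpha < cubic tau t.
Proof.
move=> a0 asqrt /andP[+ ta]; have := le_lt_trans ta asqrt => + t0.
move: t0; rewrite le_eqVlt => /predU1P[<-|t0].
  (* At [t = 0] the product in [cubicDid] vanishes, so strictness has to come from [0 < alpha]. *)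
  by rewrite /cubic expr0n /= !mulr0 subr0 oppr_lt0 a0.
rewrite (lt_escape_radius tau_gt0) ?ltW // => ht.
have : 0 < cubic tau t + t by rewrite cubicDid mulr_gt0 // subr_gt0.
lra.
Qed.

(** The lower bound is common to the regimes of [tau]; the upper bound, which differs between them,
    is left as a hypothesis. *)
Lemma abs_values_cubic_max_le alpha (tau_gt0 : 0 < tau) : 0 < alpha ->
  alpha <= Num.sqrt ((2 + tau) / tau) ->
  (forall t, 0 <= t <= alpha -> cubic tau t <= alpha) ->
  exists m : R, is_max (abs_values (cubic tau) alpha) m /\ m <= alpha.
Proof.
move=> a0 asqrt fle; have [t ta tmax] := abs_values_cubic_max (ltW a0).
exists `|cubic tau t|; split=> //.
by rewrite ler_norml fle // andbT; apply: (cubic_geN tau_gt0 asqrt).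
Qed.

Lemma abs_values_cubic_max_lt alpha (tau_gt0 : 0 < tau) : 0 < alpha ->
  alpha < Num.sqrt ((2 + tau) / tau) ->
  (forall t, 0 <= t <= alpha -> cubic tau t < alpha) ->
  exists m : R, is_max (abs_values (cubic tau) alpha) m /\ m < alpha.
Proof.
move=> a0 asqrt fle; have [t ta tmax] := abs_values_cubic_max (ltW a0).
exists `|cubic tau t|; split=> //.
by rewrite ltr_norml fle // andbT; apply: (cubic_gtN tau_gt0 a0 asqrt).
Qed.

(** * Upper bounds for small [tau] *)

Lemma cubic_subid t : t - cubic tau t = tau * (t * ((t - 1) * (t + 1))).
Proof. by rewrite /cubic; ring. Qed.

Lemma cubic_itv01 t (tau_gt0 : 0 < tau) :
  tau <= 1 / 2 -> 0 <= t <= 1 -> 0 <= cubic tau t <= 1.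
Proof.
move=> tauh /andP[t0 t1]; apply/andP; split.
  have -> : cubic tau t = t + tau * (t * ((1 - t) * (1 + t))).
    by rewrite /cubic; ring.
  by rewrite addr_ge0 // !mulr_ge0 //; lra.
rewrite -subr_ge0.
(* The fixed point 1 gives the factor [1 - t]; the other factor is nonnegative because
   [t * (1 + t) <= 2] and [tau <= 1 / 2]. *)
have -> : 1 - cubic tau t = (1 - t) * (1 - tau * (t * (1 + t))).
  by rewrite /cubic; ring.
have : t * (1 + t) <= 2 by nra.
move=> h; rewrite mulr_ge0 //; first lra.
nra.
Qed.

Lemma is_max_abs_values_cubic1 (tau_gt0 : 0 < tau) : tau <= 1 / 2 ->
  is_max (abs_values (cubic tau) 1) 1.
Proof.
move=> tauh; split.
  by exists 1; rewrite /= ?normr1 // /cubic expr1n !mulr1 addrK normr1.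
move=> _ [x /= x1 <-]; rewrite -normr_cubic.
have /andP[f0 f1] : 0 <= cubic tau `|x| <= 1.
  by apply: cubic_itv01; rewrite ?normr_ge0.
by rewrite ger0_norm.
Qed.

Lemma cubic_le t alpha (tau_gt0 : 0 < tau) :
  tau <= 1 / 2 -> 1 <= alpha -> 0 <= t <= alpha ->
  cubic tau t <= alpha.
Proof.
move=> tauh a1 /andP[t0 ta]; have [t1|t1] := leP t 1.
  by have := cubic_itv01 tau_gt0 tauh (introT andP (conj t0 t1)); lra.
suff : 0 <= t - cubic tau t by lra.
by rewrite cubic_subid !mulr_ge0 //; lra.
Qed.

Lemma cubic_lt t alpha (tau_gt0 : 0 < tau) :
  tau <= 1 / 2 -> 1 < alpha -> 0 <= t <= alpha ->
  cubic tau t < alpha.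
Proof.
move=> tauh a1 /andP[t0 ta]; have [t1|t1] := leP t 1.
  by have := cubic_itv01 tau_gt0 tauh (introT andP (conj t0 t1)); lra.
suff : 0 < t - cubic tau t by lra.
by rewrite cubic_subid !mulr_gt0 //; lra.
Qed.

(** * Divergence of the critical orbit *)

Lemma crit_point_lt1 (tau_gt0 : 0 < tau) : 2 < tau -> crit_point tau < 1.
Proof.
move=> tau2; have c0 := crit_point_gt0 tau_gt0; have := sqr_crit_point tau_gt0.
rewrite ltNge => E; apply/negP => c1.
have : 1 <= crit_point tau ^+ 2 by rewrite exprn_ege1.
nra.
Qed.

(* Squaring reduces the claim to [0 < 4 u ^+ 3 - 27 u - 27 = (u - 3) * (2 u + 3) ^+ 2],
   where [u = 1 + tau]. *)
Lemma crit_value_escapes (tau_gt0 : 0 < tau) :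
  2 < tau -> 2 + tau < tau * crit_value tau ^+ 2.
Proof.
move=> tau2; rewrite -subr_gt0 -(pmulr_rgt0 _ (_ : 0 < 27)) //.
have -> : crit_value tau = 2 / 3 * (1 + tau) * crit_point tau.
  rewrite -(cubic_crit_point tau_gt0) /cubic.
  by rewrite -(sqr_crit_point tau_gt0); field.
have -> : 27 * (tau * (2 / 3 * (1 + tau) * crit_point tau) ^+ 2 - (2 + tau)) =
    4 * (1 + tau) ^+ 2 * (3 * tau * crit_point tau ^+ 2) - 27 * (2 + tau).
  by field.
rewrite (sqr_crit_point tau_gt0).
have -> : 4 * (1 + tau) ^+ 2 * (1 + tau) - 27 * (2 + tau) =
   (tau - 2) * (2 * tau + 5) ^+ 2 by ring.
by rewrite mulr_gt0 ?exprn_gt0 //; lra.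
Qed.

(** By [cubicDid] this is [- cubic tau v - v] at [v = crit_value tau]. *)
Definition escape_step : R :=
  crit_value tau * (tau * crit_value tau ^+ 2 - (2 + tau)).

Lemma escape_step_gt0 (tau_gt0 : 0 < tau) : 2 < tau -> 0 < escape_step.
Proof.
by move=> /(crit_value_escapes tau_gt0) h;
  rewrite mulr_gt0 ?(crit_value_gt0 tau_gt0) ?subr_gt0.
Qed.

Lemma escape_step_le t (tau_gt0 : 0 < tau) :
  2 < tau -> crit_value tau <= `|t| ->
  `|t| + escape_step <= `|cubic tau t|.
Proof.
move=> tau2 ht; rewrite -normr_cubic; move: `|t| ht => {}t ht.
have v0 := crit_value_gt0 tau_gt0; have hv := crit_value_escapes tau_gt0 tau2.
have ht2 : crit_value tau ^+ 2 <= t ^+ 2 by rewrite ler_pXn2r ?nnegrE //; lra.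
apply: (@le_trans _ _ (- cubic tau t)); last by rewrite -normrN ler_norm.
rewrite -lerBrDl.
have -> : - cubic tau t - t = t * (tau * t ^+ 2 - (2 + tau)).
  by rewrite -opprD cubicDid; ring.
(* Both factors are nonnegative and increase with [t], so the gain is smallest at
   [crit_value tau]. *)
by rewrite ler_pM ?lerB ?ler_wpM2l ?subr_ge0 //; lra.
Qed.

(** The index is shifted because the orbit starts at the critical point, below 1, and only its first
    iterate reaches [crit_value tau]. *)
Lemma orbit_seq_ge n (tau_gt0 : 0 < tau) : 2 < tau ->
  crit_value tau + n%:R * escape_step <= `|orbit_seq tau n.+1|.
Proof.
move=> tau2; have d0 := escape_step_gt0 tau_gt0 tau2; elim: n => [|n IHn].
  by rewrite mul0r addr0 /orbit_seq /= (cubic_crit_point tau_gt0) ler_norm.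
have nd : 0 <= n%:R * escape_step by rewrite mulr_ge0 // ltW.
rewrite -natr1 mulrDl mul1r addrA (le_trans _ (escape_step_le _ tau2 _)) ?lerD2r //.
by rewrite (le_trans _ IHn) // lerDl.
Qed.

Lemma orbit_seq_cvgy (tau_gt0 : 0 < tau) :
  2 < tau -> `|orbit_seq tau n| @[n --> \oo] --> +oo.
Proof.
move=> tau2; have d0 := escape_step_gt0 tau_gt0 tau2.
have v0 := crit_value_gt0 tau_gt0; rewrite -(cvg_shiftS (fun n => `|orbit_seq tau n|)).
apply: (@ger_cvgy _ _ _ _ (fun n => n%:R * escape_step)).
  near=> n; apply: le_trans (orbit_seq_ge n tau_gt0 tau2).
  by rewrite lerDr ltW.
apply/cvgryPge => A; near=> n.
rewrite -ler_pdivrMr //; near: n.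
exact: nbhs_infty_ger.
Unshelve. all: by end_near. Qed.

End Cubic.

Theorem proposition1p1 (R : realType) (tau : R) (tau_gt0 : 0 < tau) :
  [/\ (tau <= 1 / 2 ->
        [/\ is_max (abs_values (cubic tau) 1) 1,
            (forall alpha : R, 1 <= alpha -> alpha <= Num.sqrt (1 + 2 / tau) ->
               exists m : R, is_max (abs_values (cubic tau) alpha) m /\ m <= alpha)
          & (forall alpha : R, 1 < alpha -> alpha < Num.sqrt (1 + 2 / tau) ->
               exists m : R, is_max (abs_values (cubic tau) alpha) m /\ m < alpha)]),
      (1 / 2 <= tau -> tau <= 2 ->
        (forall alpha : R,
           crit_value tau <= alpha -> alpha <= Num.sqrt ((2 + tau) / tau) ->
           exists m : R, is_max (abs_values (cubic tau) alpha) m /\ m <= alpha) /\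
        (forall alpha : R,
           crit_value tau < alpha -> alpha < Num.sqrt ((2 + tau) / tau) ->
           exists m : R, is_max (abs_values (cubic tau) alpha) m /\ m < alpha))
    & (2 < tau ->
        (0 < crit_point tau < 1) /\
        (`|orbit_seq tau n| @[n --> \oo] --> +oo))].
Proof.
(* Both upper limits for [alpha] are the same escape radius. *)
have -> : 1 + 2 / tau = (2 + tau) / tau by field; lra.
have v0 := crit_value_gt0 tau_gt0.
split.
- move=> tauh; split; first exact: is_max_abs_values_cubic1.
  + move=> alpha a1 asqrt; apply: abs_values_cubic_max_le => //; first lra.
    by move=> t; apply: cubic_le.
  + move=> alpha a1 asqrt; apply: abs_values_cubic_max_lt => //; first lra.
    by move=> t; apply: cubic_lt.
- move=> _ _; split=> alpha va asqrt.
  + apply: abs_values_cubic_max_le => //; first lra.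
    by move=> t /andP[t0 _]; apply: le_trans va; apply: cubic_le_crit_value.
  + apply: abs_values_cubic_max_lt => //; first lra.
    by move=> t /andP[t0 _]; apply: le_lt_trans va; apply: cubic_le_crit_value.
- move=> tau2; split; last exact: orbit_seq_cvgy.
  by rewrite crit_point_gt0 ?crit_point_lt1.
Qed.
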